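(* Let $\Lambda$ be a semiprimary ring. Then $\mathsf{Fin.dim}\,\Lambda$ is at most the supremum of the injective dimensions of the simple $\Lambda$-modules $S$ such that the projective cover of $S$ has non-maximal Loewy length. In particular, if $\Lambda$ has quasi-uniform Loewy length, then $\mathsf{Fin.dim}\,\Lambda$ is finite.
   Context: Rings are associative with unit and modules are left modules. A ring $\Lambda$ is semiprimary if $\Lambda/J(\Lambda)$ is semisimple and the Jacobson radical $J(\Lambda)$ is nilpotent. The Loewy length of a $\Lambda$-module $M$ is the least $t\ge0$ with $J(\Lambda)^tM=0$; the Loewy length of $\Lambda$ is that of the regular module ${}_\Lambda\Lambda$. The Loewy length of a module is called maximal if it equals the Loewy length of $\Lambda$, and non-maximal otherwise. Fix a complete set $\{e_i\}_i$ of primitive orthogonal idempotents of $\Lambda$ and let $e_\infty$ be the sum of those $e_i$ for which the simple module $\Lambda e_i/J(\Lambda)e_i$ has infinite injective dimension. $\Lambda$ has quasi-uniform Loewy length (from the left) if every indecomposable projective module occurring as a direct summand of $\Lambda e_\infty$ has maximal Loewy length. $\mathsf{Fin.dim}\,\Lambda$ is the supremum of the projective dimensions of all left $\Lambda$-modules of finite projective dimension. The supremum of the empty set is taken to be $0$. *)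

(* Defs.v *)
From HB Require Import structures.
From mathcomp Require Import all_boot all_order all_algebra.
From mathcomp Require Import boolp.

Set Implicit Arguments.
Unset Strict Implicit.
Unset Printing Implicit Defensive.

Import GRing.Theory.

Local Open Scope ring_scope.
Local Open Scope quotient_scope.

(* Extended natural numbers, [None] being infinity. *)
Definition enat := option nat.

Definition lee_nat (x y : enat) : Prop :=
  match x, y with
  | _, None => True
  | None, Some _ => False
  | Some m, Some n => (m <= n)%N
  end.

(* The least [n] satisfying [P], and infinity if there is none. *)
Definition einf (P : nat -> Prop) : enat :=
  match pselect (exists n, `[< P n >]) with
  | left exP => Some (ex_minn exP)
  | right _ => None
  end.

(* Supremum in the extended naturals, as the least upper bound; in particular
   the supremum of the empty set is 0. *)
Definition esup (A : enat -> Prop) : enat :=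
  einf (fun n => forall x, A x -> lee_nat x (Some n)).

(* A left R-module is an [lmodType R], a submodule of M is a [submodClosed M],
   and a left ideal of R is a submodule of the regular module [R^o]. *)

Record submod_of (R : pzRingType) (M : lmodType R) (N : submodClosed M) :=
  Submod { submod_val : M; _ : submod_val \in N }.
HB.instance Definition _ (R : pzRingType) (M : lmodType R)
  (N : submodClosed M) := [isSub of submod_of N for @submod_val R M N].
HB.instance Definition _ (R : pzRingType) (M : lmodType R)
  (N : submodClosed M) := [Choice of submod_of N by <:].
HB.instance Definition _ (R : pzRingType) (M : lmodType R)
  (N : submodClosed M) := [SubChoice_isSubLmodule of submod_of N by <:].

Definition submod_pred (R : pzRingType) (M : lmodType R)
    (N : submodClosed M) : {pred M} := fun x => x \in N.
Lemma submod_pred_zmod (R : pzRingType) (M : lmodType R)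
    (N : submodClosed M) : zmod_closed (submod_pred N).
Proof. exact: (submodClosedP N). Qed.
HB.instance Definition _ (R : pzRingType) (M : lmodType R)
  (N : submodClosed M) :=
  GRing.isZmodClosed.Build M (submod_pred N) (submod_pred_zmod N).

Definition quot_mod (R : pzRingType) (M : lmodType R) (N : submodClosed M) :=
  Quotient.quot (submod_pred N).
HB.instance Definition _ (R : pzRingType) (M : lmodType R)
  (N : submodClosed M) := GRing.Zmodule.on (quot_mod N).

Definition quot_pi (R : pzRingType) (M : lmodType R) (N : submodClosed M) :
    M -> quot_mod N := \pi_(Quotient.quot (submod_pred N)).

Definition quot_repr (R : pzRingType) (M : lmodType R) (N : submodClosed M)
    (q : quot_mod N) : M := repr (q : Quotient.quot (submod_pred N)).

Lemma quot_reprK (R : pzRingType) (M : lmodType R) (N : submodClosed M)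
    (q : quot_mod N) : quot_pi N (quot_repr q) = q.
Proof. exact: reprK. Qed.

Lemma quot_pi_eq (R : pzRingType) (M : lmodType R) (N : submodClosed M)
    (x y : M) : quot_pi N x = quot_pi N y <-> x - y \in N.
Proof.
have E : (x - y \in N) = (x == y %[mod Quotient.quot (submod_pred N)]).
  exact: (@Quotient.idealrBE M (submod_pred N) x y).
by rewrite E; split => [/eqP | /eqP].
Qed.

Lemma quot_piD (R : pzRingType) (M : lmodType R) (N : submodClosed M)
    (x y : M) : quot_pi N (x + y) = quot_pi N x + quot_pi N y.
Proof.
exact: (raddfD (\pi_(Quotient.quot (submod_pred N)) : {additive _ -> _})).
Qed.

Definition quot_scale (R : pzRingType) (M : lmodType R) (N : submodClosed M)
    (a : R) (q : quot_mod N) : quot_mod N := quot_pi N (a *: quot_repr q).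

Lemma quot_scale_pi (R : pzRingType) (M : lmodType R) (N : submodClosed M)
    (a : R) (x : M) : quot_scale a (quot_pi N x) = quot_pi N (a *: x).
Proof.
by apply/quot_pi_eq; rewrite -scalerBr; apply/rpredZ/quot_pi_eq/quot_reprK.
Qed.

Lemma quot_scaleA (R : pzRingType) (M : lmodType R) (N : submodClosed M)
    (a b : R) (q : quot_mod N) :
  quot_scale a (quot_scale b q) = quot_scale (a * b) q.
Proof. by rewrite -(quot_reprK q) !quot_scale_pi scalerA. Qed.

Lemma quot_scale1 (R : pzRingType) (M : lmodType R) (N : submodClosed M) :
  left_id 1 (@quot_scale R M N).
Proof. by move=> q; rewrite -(quot_reprK q) quot_scale_pi scale1r. Qed.

Lemma quot_scaleDr (R : pzRingType) (M : lmodType R) (N : submodClosed M) :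
  right_distributive (@quot_scale R M N) +%R.
Proof.
move=> a p q; rewrite -(quot_reprK p) -(quot_reprK q) -quot_piD.
by rewrite !quot_scale_pi scalerDr quot_piD.
Qed.

Lemma quot_scaleDl (R : pzRingType) (M : lmodType R) (N : submodClosed M)
    (q : quot_mod N) :
  {morph (@quot_scale R M N)^~ q : a b / a + b}.
Proof.
by move=> a b /=; rewrite -(quot_reprK q) !quot_scale_pi scalerDl quot_piD.
Qed.

HB.instance Definition _ (R : pzRingType) (M : lmodType R)
    (N : submodClosed M) :=
  GRing.Zmodule_isLmodule.Build R (quot_mod N)
    (@quot_scaleA R M N) (@quot_scale1 R M N)
    (@quot_scaleDr R M N) (@quot_scaleDl R M N).

Definition is_zero_mod (R : pzRingType) (M : lmodType R) : Prop :=
  forall x : M, x = 0.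

Definition simple_mod (R : pzRingType) (M : lmodType R) : Prop :=
  ~ is_zero_mod M /\
  forall N : submodClosed M,
    (forall x : M, x \in N -> x = 0) \/ (forall x : M, x \in N).

(* M is the internal direct sum of A and B. *)
Definition direct_decomp (R : pzRingType) (M : lmodType R)
    (A B : submodClosed M) : Prop :=
  (forall x : M, x \in A -> x \in B -> x = 0) /\
  (forall x : M, exists a b : M, [/\ a \in A, b \in B & x = a + b]).

Definition semisimple_mod (R : pzRingType) (M : lmodType R) : Prop :=
  forall A : submodClosed M, exists B : submodClosed M, direct_decomp A B.

Definition indecomposable_mod (R : pzRingType) (M : lmodType R) : Prop :=
  ~ is_zero_mod M /\
  forall A B : submodClosed M, direct_decomp A B ->
    (forall x : M, x \in A -> x = 0) \/ (forall x : M, x \in B -> x = 0).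

Definition is_direct_summand (R : pzRingType) (P M : lmodType R) : Prop :=
  exists (Q : lmodType R) (f : {linear (P * Q)%type -> M}), bijective f.

Definition surjective_fun (A B : Type) (f : A -> B) : Prop :=
  forall y, exists x, f x = y.

Definition exact_at (R : pzRingType) (A B C : lmodType R)
    (f : A -> B) (g : B -> C) : Prop :=
  forall y, g y = 0 <-> exists x, f x = y.

Definition projective_mod (R : pzRingType) (P : lmodType R) : Prop :=
  forall (M N : lmodType R) (g : {linear M -> N}) (f : {linear P -> N}),
    surjective_fun g -> exists h : {linear P -> M}, forall x, g (h x) = f x.

Definition injective_mod (R : pzRingType) (I : lmodType R) : Prop :=
  forall (N M : lmodType R) (g : {linear N -> M}) (f : {linear N -> I}),
    injective g -> exists h : {linear M -> I}, forall x, h (g x) = f x.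

(* There is an exact sequence 0 -> P n -> ... -> P 0 -> M -> 0 with every P i
   projective. *)
Definition proj_resolution_le (R : pzRingType) (M : lmodType R) (n : nat) :
    Prop :=
  exists (P : nat -> lmodType R) (d : forall i, {linear P i.+1 -> P i})
         (eps : {linear P 0%N -> M}),
    [/\ forall i, projective_mod (P i),
        surjective_fun eps,
        exact_at (d 0%N) eps,
        forall i, exact_at (d i.+1) (d i)
      & forall i, (n < i)%N -> is_zero_mod (P i)].

(* There is an exact sequence 0 -> M -> I 0 -> ... -> I n -> 0 with every I i
   injective. *)
Definition inj_resolution_le (R : pzRingType) (M : lmodType R) (n : nat) :
    Prop :=
  exists (I : nat -> lmodType R) (d : forall i, {linear I i -> I i.+1})
         (eta : {linear M -> I 0%N}),
    [/\ forall i, injective_mod (I i),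
        injective eta,
        exact_at eta (d 0%N),
        forall i, exact_at (d i) (d i.+1)
      & forall i, (n < i)%N -> is_zero_mod (I i)].

Definition projdim (R : pzRingType) (M : lmodType R) : enat :=
  einf (proj_resolution_le M).

Definition injdim (R : pzRingType) (M : lmodType R) : enat :=
  einf (inj_resolution_le M).

Definition Findim (R : pzRingType) : enat :=
  esup (fun d => exists M : lmodType R, projdim M <> None /\ d = projdim M).

Definition maximal_left_ideal (R : pzRingType) (m : submodClosed R^o) : Prop :=
  (exists x : R^o, x \notin m) /\
  forall N : submodClosed R^o, {subset m <= N} ->
    {subset N <= m} \/ (forall x : R^o, x \in N).

Definition jacobson (R : pzRingType) : {pred R^o} :=
  fun x => `[< forall m : submodClosed R^o, maximal_left_ideal m -> x \in m >].
Arguments jacobson : clear implicits.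

Lemma jacobson_submod (R : pzRingType) : submod_closed (jacobson R).
Proof.
split; first by apply/asboolP => m _; apply: rpred0.
move=> a u v /asboolP Ju /asboolP Jv; apply/asboolP => m mm.
by apply: rpredD; [apply: rpredZ; apply: Ju | apply: Jv].
Qed.
HB.instance Definition _ (R : pzRingType) :=
  GRing.isSubmodClosed.Build R R^o (jacobson R) (@jacobson_submod R).

(* J(R) N: the finite sums of products a *: u with a in J(R) and u in N. *)
Definition jacobson_mul (R : pzRingType) (M : lmodType R) (N : {pred M}) :
    {pred M} :=
  fun x => `[< exists (n : nat) (a : 'I_n -> R^o) (u : 'I_n -> M),
     [/\ forall i, a i \in jacobson R, forall i, u i \in N
       & x = \sum_(i < n) (a i : R) *: u i] >].

Lemma jacobson_mul_submod (R : pzRingType) (M : lmodType R) (N : {pred M}) :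
  submod_closed (jacobson_mul N).
Proof.
split.
  apply/asboolP; exists 0%N, (fun=> 0), (fun=> 0).
  by split; [case | case | rewrite big_ord0].
move=> c x y /asboolP[n [a [u [Ja Nu ->]]]] /asboolP[p [b [v [Jb Nv ->]]]].
apply/asboolP; exists (n + p)%N.
exists (fun i => match split i with inl j => c *: a j | inr k => b k end).
exists (fun i => match split i with inl j => u j | inr k => v k end).
split.
- by move=> i; case: (split i) => j //; apply: rpredZ.
- by move=> i; case: (split i).
- rewrite big_split_ord scaler_sumr; congr (_ + _); apply: eq_bigr => i _.
  + by rewrite -[lshift p i]/(unsplit (inl i)) unsplitK scalerA.
  + by rewrite -[rshift n i]/(unsplit (inr i)) unsplitK.
Qed.
HB.instance Definition _ (R : pzRingType) (M : lmodType R) (N : {pred M}) :=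
  GRing.isSubmodClosed.Build R M (jacobson_mul N) (jacobson_mul_submod N).

(* J(R)^t M. For M = R^o this is the ideal power J(R)^t. *)
Definition jacobson_pow (R : pzRingType) (M : lmodType R) (t : nat) :
    {pred M} :=
  iter t (@jacobson_mul R M) predT.
Arguments jacobson_pow {R} M t _.

(* The quotient R / J(R) is taken in the category of left R-modules; its
   R-submodules are exactly the left ideals of the ring R / J(R). *)
Definition semiprimary (R : pzRingType) : Prop :=
  semisimple_mod (quot_mod (jacobson R)) /\
  exists n, forall x : R^o, x \in jacobson_pow R^o n -> x = 0.

Definition loewy_length (R : pzRingType) (M : lmodType R) : enat :=
  einf (fun t => forall x : M, x \in jacobson_pow M t -> x = 0).

Definition maximal_loewy (R : pzRingType) (M : lmodType R) : Prop :=
  loewy_length M = loewy_length R^o.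

Definition superfluous (R : pzRingType) (M : lmodType R) (K : M -> Prop) :
    Prop :=
  forall N : submodClosed M,
    (forall x : M, exists k n : M, [/\ K k, n \in N & x = k + n]) ->
    forall x : M, x \in N.

Definition projective_cover (R : pzRingType) (P M : lmodType R)
    (p : {linear P -> M}) : Prop :=
  [/\ projective_mod P, surjective_fun p & superfluous (fun x => p x = 0)].

Definition principal_left (R : pzRingType) (e : R) : {pred R^o} :=
  fun x => `[< exists a : R, x = a * e >].

Lemma principal_left_submod (R : pzRingType) (e : R) :
  submod_closed (principal_left e).
Proof.
split; first by apply/asboolP; exists 0; rewrite mul0r.
move=> c x y /asboolP[a ->] /asboolP[b ->]; apply/asboolP.
by exists (c * a + b); rewrite mulrDl -mulrA.
Qed.
HB.instance Definition _ (R : pzRingType) (e : R) :=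
  GRing.isSubmodClosed.Build R R^o (principal_left e)
    (principal_left_submod e).

Definition Rmod (R : pzRingType) (e : R) : lmodType R :=
  submod_of (principal_left e).

(* M / J(R) M. For M = R e this is R e / J(R) e, since J(R) R e = J(R) e. *)
Definition top_mod (R : pzRingType) (M : lmodType R) : lmodType R :=
  quot_mod (@jacobson_mul R M predT).

Definition idempotent_elt (R : pzRingType) (e : R) : Prop := e * e = e.

Definition primitive_idempotent (R : pzRingType) (e : R) : Prop :=
  [/\ idempotent_elt e, e <> 0
    & forall f g : R, idempotent_elt f -> idempotent_elt g ->
        f * g = 0 -> g * f = 0 -> e = f + g -> f = 0 \/ g = 0].

Definition complete_primitive_orthogonal (R : pzRingType) (n : nat)
    (e : 'I_n -> R) : Prop :=
  [/\ forall i, primitive_idempotent (e i),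
      forall i j, i != j -> e i * e j = 0
    & \sum_(i < n) e i = 1].

Definition e_infty (R : pzRingType) (n : nat) (e : 'I_n -> R) : R :=
  \sum_(i < n | `[< injdim (top_mod (Rmod (e i))) = None >]) e i.

Definition quasi_uniform_loewy (R : pzRingType) (n : nat) (e : 'I_n -> R) :
    Prop :=
  forall P : lmodType R, indecomposable_mod P -> projective_mod P ->
    is_direct_summand P (Rmod (e_infty e)) -> maximal_loewy P.

(* Main.v *)
From HB Require Import structures.
Require Import Defs.
From mathcomp Require Import all_boot all_order all_algebra.
From mathcomp Require Import boolp.
From mathcomp Require classical_sets.

Set Implicit Arguments.
Unset Strict Implicit.
Unset Printing Implicit Defensive.

Import GRing.Theory.

Local Open Scope ring_scope.

(** Let M be a module of projective dimension d > 0 and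
      0 -> P d -> P (d - 1) -> ... -> P 0 -> M -> 0
    a projective resolution; write i : P d -> P (d - 1).  If i detected the
    radical, in the sense that i x in J P (d - 1) forces x in J (P d), then i
    would split: P (d - 1) / J P (d - 1) is semisimple, so the injection of
    tops has a retraction; it lifts to a map back to P d, which inverts i up
    to J, hence up to an automorphism as J is nilpotent
    ([radical_injection_split]).  A split i would shorten the resolution
    ([split_truncation]).  So some x outside J (P d) has i x in J P (d - 1).

    Put the annihilator of x modulo J (P d) inside a maximal left ideal m, let
    S = R / m, and let e be an idempotent of R such that R e covers S.  Then
    r |-> r x embeds R e in P d, and i maps this copy of R e into
    J P (d - 1), which is killed by J ^ (L - 1), where L is the Loewy length
    of R.  Hence the projective cover of S has non-maximal Loewy length.
    Moreover some f : P d -> S does not vanish at e x, whereas every map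
    P d -> S that factors through i vanishes there because J S = 0
    ([simple_top_of_radical_map]).  So f is a nonzero class in Ext ^ d (M, S),
    and the injective dimension of S is at least d ([ext_vanishing]),
    which gives the first claim.

    For the second claim, every simple module is the top of some R (e i)
    ([simple_iso_top]); if its cover has non-maximal Loewy length, quasi-
    uniformity keeps R (e i) out of R e_infty, so its injective dimension is
    finite.  The supremum thus ranges over finitely many finite values. *)

Local Notation rad M := (jacobson_mul (predT : {pred M})).

(** * Least values in the extended natural numbers *)

Lemma einfP (P : nat -> Prop) :
  match einf P with
  | Some n => P n /\ forall m, P m -> (n <= m)%N
  | None => forall n, ~ P n
  end.
Proof.
rewrite /einf; case: pselect => [exP|noP].
  by case: ex_minnP => n /asboolP Pn minP; split=> // m Pm; apply/minP/asboolP.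
by move=> n Pn; apply: noP; exists n; apply/asboolP.
Qed.

Lemma einf_le (P : nat -> Prop) (n : nat) : P n -> lee_nat (einf P) (Some n).
Proof. by case: (einf P) (einfP P) => [k [_]|/[apply]//]; apply. Qed.

(** * Submodules, quotients and linear maps *)

Lemma linear_exists (R : pzRingType) (M N : lmodType R) (f : M -> N) :
  linear f -> exists g : {linear M -> N}, forall x, g x = f x.
Proof.
move=> lf.
pose g : {linear M -> N} := HB.pack f (GRing.isLinear.Build R M N *:%R f lf).
by exists g.
Qed.

Lemma submod_exists (R : pzRingType) (M : lmodType R) (P : M -> Prop) :
    P 0 -> (forall a x y, P x -> P y -> P (a *: x + y)) ->
  exists N : submodClosed M, forall x, (x \in N) = `[< P x >].
Proof.
move=> P0 PD; pose S : {pred M} := fun x => `[< P x >].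
have S_closed : submod_closed S.
  split; first exact/asboolP.
  by move=> a x y /asboolP Px /asboolP Py; apply/asboolP/PD.
pose N : submodClosed M :=
  HB.pack S (GRing.isSubmodClosed.Build R M S S_closed).
by exists N.
Qed.

Lemma quot_pi_linear (R : pzRingType) (M : lmodType R) (N : submodClosed M) :
  linear (quot_pi N).
Proof.
by move=> a x y; rewrite quot_piD -quot_scale_pi.
Qed.
HB.instance Definition _ (R : pzRingType) (M : lmodType R)
  (N : submodClosed M) :=
  GRing.isLinear.Build R M (quot_mod N) *:%R (quot_pi N) (quot_pi_linear N).

Lemma quot_pi_eq0 (R : pzRingType) (M : lmodType R) (N : submodClosed M)
    (x : M) : quot_pi N x = 0 <-> x \in N.
Proof. by rewrite -[0](raddf0 (quot_pi N)) quot_pi_eq subr0. Qed.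

Lemma quot_pi_surj (R : pzRingType) (M : lmodType R) (N : submodClosed M) :
  surjective_fun (quot_pi N).
Proof. by move=> q; exists (quot_repr q); rewrite quot_reprK. Qed.

Definition submod_incl (R : pzRingType) (M : lmodType R) (N : submodClosed M) :
  {linear submod_of N -> M} := val.

Definition top_pi (R : pzRingType) (M : lmodType R) :
    {linear M -> top_mod M} := quot_pi _.

Lemma linear_preimage_submod (R : pzRingType) (M M' : lmodType R)
    (f : {linear M -> M'}) (N : submodClosed M') :
  exists K : submodClosed M, forall x, (x \in K) = (f x \in N).
Proof.
have [||K KP] := @submod_exists R M (fun x => f x \in N).
- by rewrite raddf0 rpred0.
- by move=> a x y xN yN; rewrite linearP rpredD ?rpredZ.
by exists K => x; rewrite KP asboolb.
Qed.

Section Modules.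
Variable R : pzRingType.

Lemma submodN (M : lmodType R) (N : submodClosed M) (x : M) :
  x \in N -> - x \in N.
Proof. by move=> xN; rewrite -scaleN1r rpredZ. Qed.

Lemma submodB (M : lmodType R) (N : submodClosed M) (x y : M) :
  x \in N -> y \in N -> x - y \in N.
Proof. by move=> xN yN; rewrite rpredD // submodN. Qed.

(** The map h is f composed with an arbitrary choice of preimages under u. *)
Lemma linear_factor (A B C : lmodType R) (u : {linear A -> B})
    (f : {linear A -> C}) :
    surjective_fun u -> (forall a, u a = 0 -> f a = 0) ->
  exists h : {linear B -> C}, forall a, h (u a) = f a.
Proof.
move=> u_surj kerf; have [s sK] := choice u_surj.
have fE a b : u a = u b -> f a = f b.
  move=> ab; apply/eqP; rewrite -subr_eq0 -(linearB f); apply/eqP/kerf.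
  by rewrite linearB ab subrr.
have [|h hE] := @linear_exists R B C (f \o s).
  by move=> a x y /=; rewrite -linearP; apply: fE; rewrite linearP !sK.
by exists h => a; rewrite hE /=; apply: fE; rewrite sK.
Qed.

Lemma linear_inverse (A B : lmodType R) (u : {linear A -> B}) :
    injective u -> surjective_fun u ->
  exists v : {linear B -> A}, cancel u v /\ cancel v u.
Proof.
move=> u_inj u_surj; have [|v vK] := @linear_factor A B A u idfun u_surj.
  by move=> a ua0; apply: u_inj; rewrite ua0 raddf0.
by exists v; split=> // b; have [a <-] := u_surj b; rewrite vK.
Qed.

Lemma linear_inj (A B : lmodType R) (u : {linear A -> B}) :
  (forall a, u a = 0 -> a = 0) -> injective u.
Proof.
move=> ker0 a b ab; apply/eqP; rewrite -subr_eq0; apply/eqP/ker0.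
by rewrite linearB ab subrr.
Qed.

Lemma linear_image_submod (A B : lmodType R) (u : {linear A -> B}) :
  exists N : submodClosed B, forall x, (x \in N) = `[< exists a, u a = x >].
Proof.
apply: submod_exists; first by exists 0; rewrite raddf0.
by move=> c x y [a <-] [b <-]; exists (c *: a + b); rewrite linearP.
Qed.

Lemma linear_kernel_submod (A B : lmodType R) (u : {linear A -> B}) :
  exists N : submodClosed A, forall x, (x \in N) = `[< u x = 0 >].
Proof.
apply: submod_exists; first by rewrite raddf0.
by move=> c x y xk yk; rewrite linearP xk yk scaler0 addr0.
Qed.

Lemma corestrict (A B : lmodType R) (N : submodClosed B)
    (f : {linear A -> B}) :
    (forall x, f x \in N) ->
  exists g : {linear A -> submod_of N}, forall x, val (g x) = f x.
Proof.
move=> fN; have [|g gE] :=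
    @linear_exists R A (submod_of N) (fun x => Sub (f x) (fN x)).
  by move=> a x y; apply: val_inj; rewrite /= linearP.
by exists g => x; rewrite gE.
Qed.

(** Extension along a map that need not be injective: pass to the quotient by
    its kernel, on which f is still defined. *)
Lemma injective_extend (I A B : lmodType R) (u : {linear A -> B})
    (f : {linear A -> I}) :
    injective_mod I -> (forall a, u a = 0 -> f a = 0) ->
  exists h : {linear B -> I}, forall a, h (u a) = f a.
Proof.
move=> injI kerf; have [K KE] := linear_kernel_submod u.
have piK a : quot_pi K a = 0 -> u a = 0.
  by move/quot_pi_eq0; rewrite KE => /asboolP.
have [u' u'E] := linear_factor (@quot_pi_surj _ _ K) piK.
have [f' f'E] :=
  linear_factor (@quot_pi_surj _ _ K) (fun a h => kerf a (piK a h)).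
have u'_inj : injective u'.
  apply: linear_inj => q; have [a <-] := quot_pi_surj q.
  by rewrite u'E => ua0; apply/quot_pi_eq0; rewrite KE; apply/asboolP.
have [h hE] := injI _ _ u' f' u'_inj.
by exists h => a; rewrite -u'E hE f'E.
Qed.

(** Lifting through a map that need not be surjective: restrict the target to
    its image. *)
Lemma projective_lift (P M N : lmodType R) (g : {linear M -> N})
    (f : {linear P -> N}) :
    projective_mod P -> (forall x, exists y, g y = f x) ->
  exists h : {linear P -> M}, forall x, g (h x) = f x.
Proof.
move=> projP fg; have [I IE] := linear_image_submod g.
have [|g' g'E] := @corestrict _ _ I g.
  by move=> x; rewrite IE; apply/asboolP; exists x.
have [|f' f'E] := @corestrict _ _ I f.
  by move=> x; rewrite IE; apply/asboolP/fg.
have [|h hE] := projP _ _ g' f'.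
  move=> y; have := valP y; rewrite IE => /asboolP[x xy].
  by exists x; apply: val_inj; rewrite g'E.
by exists h => x; rewrite -g'E hE f'E.
Qed.

(** Zorn's lemma in the form that yields both maximal left ideals (avoid 1)
    and maximal submodules disjoint from a given one (avoid its nonzero
    elements). *)
Lemma maximal_avoiding (M : lmodType R) (N0 : submodClosed M) (X : M -> Prop) :
    (forall x, x \in N0 -> ~ X x) ->
  exists N : submodClosed M,
    [/\ {subset N0 <= N}, forall x, x \in N -> ~ X x
      & forall N' : submodClosed M, {subset N <= N'} ->
          (forall x, x \in N' -> ~ X x) -> {subset N' <= N}].
Proof.
move=> N0X.
pose T := {N : submodClosed M | {subset N0 <= N} /\ forall x, x \in N -> ~ X x}.
pose t0 : T := exist _ N0 (conj (fun _ h => h) N0X).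
pose le : rel T := fun s t => `[< {subset sval s <= sval t} >].
have [| | |[N [N0N NX]] Nmax] := @classical_sets.ZL_preorder T t0 le.
- by move=> t; apply/asboolP.
- by move=> r s t /asboolP rs /asboolP st; apply/asboolP => x /rs /st.
- move=> C C_total; have [[s0 Cs0]|C0] := pselect (exists s, C s); last first.
    by exists t0 => s Cs; case: C0; exists s.
  have [||U UE] := @submod_exists R M (fun x => exists2 s, C s & x \in sval s).
  + by exists s0; rewrite ?rpred0.
  + move=> a x y [s Cs xs] [t Ct yt].
    have [/asboolP st|/asboolP ts] := C_total s t Cs Ct.
      by exists t => //; rewrite rpredD // rpredZ // st.
    by exists s => //; rewrite rpredD ?rpredZ // ts.
  have U_ok : {subset N0 <= U} /\ forall x, x \in U -> ~ X x.
    split=> x.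
      move=> xN0; rewrite UE; apply/asboolP; exists s0 => //.
      by case: (svalP s0) => + _; apply.
    by rewrite UE => /asboolP[s Cs xs]; case: (svalP s) => _; apply.
  exists (exist _ U U_ok) => s Cs; apply/asboolP => x xs /=.
  by rewrite UE; apply/asboolP; exists s.
exists N; split=> // N' NN' N'X.
have N'_ok : {subset N0 <= N'} /\ forall x, x \in N' -> ~ X x.
  by split=> // x /N0N /NN'.
have := Nmax (exist _ N' N'_ok); rewrite /le /= => h.
by apply/asboolP/h/asboolP.
Qed.

(** * The Jacobson radical *)

Lemma mem_jacobson_mul (M : lmodType R) (N : {pred M}) (a : R) (u : M) :
  (a : R^o) \in jacobson R -> u \in N -> a *: u \in jacobson_mul N.
Proof.
move=> Ja Nu; apply/asboolP; exists 1%N, (fun=> a), (fun=> u).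
by rewrite big_ord1.
Qed.

Lemma jacobson_mul_sub (M : lmodType R) (N : {pred M}) (N' : submodClosed M) :
    (forall (a : R) u, (a : R^o) \in jacobson R -> u \in N -> a *: u \in N') ->
  {subset jacobson_mul N <= N'}.
Proof.
move=> JN x /asboolP[n [a [u [Ja Nu ->]]]].
by apply: rpred_sum => i _; apply: JN.
Qed.

Lemma linear_jacobson_mul (M M' : lmodType R) (f : {linear M -> M'})
    (N : {pred M}) (N' : {pred M'}) :
    (forall x, x \in N -> f x \in N') ->
  forall x, x \in jacobson_mul N -> f x \in jacobson_mul N'.
Proof.
move=> fN; have [K KE] := linear_preimage_submod f (jacobson_mul N').
move=> x xJN; rewrite -KE; apply: jacobson_mul_sub x xJN => a u Ja Nu.
by rewrite KE linearZ mem_jacobson_mul // fN.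
Qed.

(** A left ideal N strictly above the annihilator of s satisfies N s = S, so
    s = a s for some a in N; then 1 - a annihilates s and 1 lies in N. *)
Lemma maximal_left_ideal_ann (S : lmodType R) (s : S) (m : submodClosed R^o) :
    simple_mod S -> s <> 0 -> (forall a : R, (a \in m) = `[< a *: s = 0 >]) ->
  maximal_left_ideal m.
Proof.
move=> [_ Ssimple] s0 mE; split.
  by exists 1; rewrite mE scale1r; apply/asboolPn.
move=> N mN.
have [||U UE] := @submod_exists R S
  (fun x => exists2 a : R, (a : R^o) \in N & a *: s = x).
- by exists 0; rewrite ?rpred0 ?scale0r.
- move=> c x y [a aN <-] [b bN <-].
  exists (c * a + b); last by rewrite scalerDl scalerA.
  by apply: rpredD => //; apply: (@rpredZ R R^o N c).
have [U0|U1] := Ssimple U.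
  left=> a aN; rewrite mE; apply/asboolP/U0.
  by rewrite UE; apply/asboolP; exists a.
right=> x; have := U1 s; rewrite UE => /asboolP[a aN as1].
have : (1 - a : R^o) \in N.
  by apply: mN; rewrite mE scalerBl as1 scale1r subrr; apply/asboolP.
move/(rpredD aN); rewrite addrC subrK => N1.
by have := @rpredZ R R^o N x _ N1; rewrite /GRing.scale /= mulr1.
Qed.

Lemma jacobson_simple (S : lmodType R) (a : R) (s : S) :
  simple_mod S -> (a : R^o) \in jacobson R -> a *: s = 0.
Proof.
move=> Ssimple /asboolP Ja.
have [->|s0] := pselect (s = 0); first by rewrite scaler0.
have [||m mE] := @submod_exists R R^o (fun a => (a : R) *: s = 0).
- by rewrite scale0r.
- by move=> c x y xs ys; rewrite scalerDl ys -scalerA xs scaler0 addr0.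
have /Ja := maximal_left_ideal_ann Ssimple s0 mE.
by rewrite mE => /asboolP.
Qed.

Lemma maximal_quot_simple (m : submodClosed R^o) :
  maximal_left_ideal m -> simple_mod (quot_mod m).
Proof.
move=> [[x xm] mmax]; split.
  by move=> /(_ (quot_pi m x)) /quot_pi_eq0 h; rewrite h in xm.
move=> N; have [K KE] := linear_preimage_submod (quot_pi m) N.
have [|Km|K1] := mmax K.
- move=> y /quot_pi_eq0 ym.
  by rewrite KE (ym : (quot_pi m : {linear _ -> _}) y = 0) rpred0.
- left=> q; have [y <-] := quot_pi_surj q; rewrite -KE => /Km ym.
  exact/quot_pi_eq0.
by right=> q; have [y <-] := quot_pi_surj q; rewrite -KE.
Qed.

Lemma jacobson_mul_simple (M S : lmodType R) (f : {linear M -> S}) (x : M) :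
  simple_mod S -> x \in rad M -> f x = 0.
Proof.
move=> Ssimple; have [K KE] := linear_kernel_submod f.
suff sub : {subset rad M <= K}.
  by move/sub; rewrite KE => /asboolP.
apply: jacobson_mul_sub => a u Ja _; rewrite KE; apply/asboolP.
by rewrite linearZ; apply: jacobson_simple.
Qed.

(** The radical, defined by maximal left ideals, is two-sided: r acts on each
    simple quotient R / m, and the radical kills R / m. *)
Lemma jacobson_mulr (a r : R) :
  (a : R^o) \in jacobson R -> (a * r : R^o) \in jacobson R.
Proof.
move=> Ja; apply/asboolP => m mmax; apply/quot_pi_eq0.
have -> : (a * r : R^o) = a *: (r : R^o) by [].
by rewrite linearZ; apply: jacobson_simple (maximal_quot_simple mmax) Ja.
Qed.
End Modules.

(** * Semisimplicity modulo the radical, and nilpotence *)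

Section Semiprimary.
Variable R : pzRingType.

Lemma jacobson_top (M : lmodType R) (a : R) (v : top_mod M) :
  (a : R^o) \in jacobson R -> a *: v = 0.
Proof.
move=> Ja; have [x <-] := quot_pi_surj v; rewrite -linearZ.
by apply/quot_pi_eq0/mem_jacobson_mul.
Qed.

Lemma scaler_linear (M : lmodType R) (x : M) :
  exists f : {linear R^o -> M}, forall a, f a = (a : R) *: x.
Proof.
by apply: linear_exists => c a b; rewrite scalerDl scalerA.
Qed.

Lemma mem_left_ideal_mull (I : submodClosed R^o) (a b : R) :
  (b : R^o) \in I -> (a * b : R^o) \in I.
Proof. exact: (@rpredZ R R^o I a). Qed.

(** Semisimplicity of R / J pulled back to R.  When I contains J, the element c
    is idempotent modulo J and generates a complement of I / J. *)
Lemma left_ideal_complement (I : submodClosed R^o) :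
    semisimple_mod (quot_mod (jacobson R)) ->
  exists C : submodClosed R^o,
    [/\ {subset jacobson R <= C},
        forall x, x \in C -> x \in I -> x \in jacobson R
      & exists2 c : R, (c : R^o) \in C & (1 - c : R^o) \in I].
Proof.
move=> ssR.
have [||A AE] := @submod_exists R (quot_mod (jacobson R))
  (fun q => exists2 x, x \in I & quot_pi (jacobson R) x = q).
- by exists 0; rewrite ?rpred0 ?raddf0.
- move=> a _ _ [x xI <-] [y yI <-].
  by exists (a *: x + y); rewrite ?linearP ?rpredD ?rpredZ.
have [B [AB0 AB1]] := ssR A.
have [C CE] := linear_preimage_submod (quot_pi (jacobson R)) B.
exists C; split.
- move=> x /quot_pi_eq0 xJ.
  by rewrite CE (xJ : (quot_pi _ : {linear _ -> _}) x = 0) rpred0.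
- move=> x; rewrite CE => xB xI; apply/quot_pi_eq0; apply: AB0 xB.
  by rewrite AE; apply/asboolP; exists x.
have [a [b [aA bB one]]] := AB1 (quot_pi (jacobson R) 1).
move: aA; rewrite AE => /asboolP[x xI xa].
exists (1 - x); last by rewrite opprB addrC subrK.
by rewrite CE linearB /= one -xa addrC addKr.
Qed.

(** Take B maximal among the submodules meeting A trivially.  For v in V, let
    I be the left ideal of all a with a v in A + B, and split 1 = c + (1 - c)
    along a complement C of I modulo J.  Enlarging B by R c v creates no
    intersection with A, because r c v in A + B puts r c in C and in I, hence
    in J, which kills v.  So c v is in B by maximality, and v is in A + B. *)
Lemma killed_semisimple (V : lmodType R) :
    semisimple_mod (quot_mod (jacobson R)) ->
    (forall (a : R) (v : V), (a : R^o) \in jacobson R -> a *: v = 0) ->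
  semisimple_mod V.
Proof.
move=> ssR JV A.
have [||Z ZE] := @submod_exists R V (fun x => x = 0) => //.
  by move=> a _ _ -> ->; rewrite scaler0 addr0.
have [|B [_ BA Bmax]] := @maximal_avoiding R V Z (fun x => x \in A /\ x <> 0).
  by move=> x; rewrite ZE => /asboolP -> [].
exists B; split=> [x xA xB|v].
  by apply: contrapT => x0; apply: (BA x xB).
have [||AB ABE] := @submod_exists R V
  (fun v => exists a b, [/\ a \in A, b \in B & v = a + b]).
- by exists 0, 0; rewrite !rpred0 addr0.
- move=> c _ _ [a [b [aA bB ->]]] [a' [b' [a'A b'B ->]]].
  exists (c *: a + a'), (c *: b + b'); rewrite !rpredD ?rpredZ //; split=> //.
  by rewrite scalerDr addrACA.
have AB_A x : x \in A -> x \in AB.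
  by move=> xA; rewrite ABE; apply/asboolP; exists x, 0; rewrite rpred0 addr0.
have AB_B x : x \in B -> x \in AB.
  by move=> xB; rewrite ABE; apply/asboolP; exists 0, x; rewrite rpred0 add0r.
suff : v \in AB by rewrite ABE => /asboolP.
have [fv fvE] := scaler_linear v.
have [I IE] := linear_preimage_submod fv AB.
have [C [_ CI [c cC c1I]]] := left_ideal_complement I ssR.
have [||B' B'E] := @submod_exists R V
  (fun x => exists2 b, b \in B & exists r : R, x = b + r *: (c *: v)).
- by exists 0; rewrite ?rpred0 //; exists 0; rewrite scale0r addr0.
- move=> a _ _ [b bB [r ->]] [b' b'B [r' ->]].
  exists (a *: b + b'); first by rewrite rpredD ?rpredZ.
  by exists (a * r + r'); rewrite scalerDr scalerDl scalerA addrACA.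
have cvB : c *: v \in B.
  apply: (Bmax B').
  - move=> b bB; rewrite B'E; apply/asboolP; exists b => //.
    by exists 0; rewrite scale0r addr0.
  - move=> x; rewrite B'E => /asboolP[b bB [r ->]] [xA]; apply.
    have rcI : (r * c : R^o) \in I.
      rewrite IE fvE -scalerA.
      suff : b + r *: (c *: v) - b \in AB by rewrite addrC addKr.
      by rewrite submodB ?(AB_A _ xA) ?(AB_B _ bB).
    have /(JV (r * c) v) rcv0 := CI _ (mem_left_ideal_mull r cC) rcI.
    move: xA; rewrite scalerA rcv0 addr0 => bA.
    by apply: contrapT => b0; apply: (BA b bB).
  - rewrite B'E; apply/asboolP; exists 0; rewrite ?rpred0 //.
    by exists 1; rewrite add0r scale1r.
rewrite -[v]scale1r -[1](subrK c) scalerDl rpredD //; last exact: AB_B.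
by rewrite -fvE -IE.
Qed.

(** Every module is injective relative to a semisimple one: extend f by zero on
    a complement of the image of u. *)
Lemma semisimple_extend (A V W : lmodType R) (u : {linear A -> V})
    (f : {linear A -> W}) :
    semisimple_mod V -> (forall a, u a = 0 -> f a = 0) ->
  exists h : {linear V -> W}, forall a, h (u a) = f a.
Proof.
move=> ssV kerf; have [I IE] := linear_image_submod u.
have [B [IB0 IB1]] := ssV I.
have uI a : u a \in I by rewrite IE; apply/asboolP; exists a.
have dec v : exists a, v - u a \in B.
  have [i [b [iI bB ->]]] := IB1 v.
  move: iI; rewrite IE => /asboolP[a <-].
  by exists a; rewrite addrC addKr.
have [s sB] := choice dec.
have fE v a : v - u a \in B -> f (s v) = f a.
  move=> vB; apply/eqP; rewrite -subr_eq0 -(linearB f); apply/eqP/kerf.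
  apply: IB0 => //.
  suff : (v - u a) - (v - u (s v)) \in B.
    by rewrite opprB addrC addrA subrK linearB.
  by rewrite submodB.
have [|h hE] := @linear_exists R V W (f \o s).
  move=> c x y /=; rewrite -linearP; apply: fE.
  by rewrite linearP opprD addrACA -scalerBr rpredD ?rpredZ.
by exists h => a; rewrite hE; apply: fE; rewrite subrr rpred0.
Qed.

(** The base N' is kept arbitrary so that a map with image in the radical gains
    one power: it sends J ^ t M into J ^ t (J M') = J ^ (t + 1) M'. *)
Lemma linear_jacobson_iter (M M' : lmodType R) (f : {linear M -> M'})
    (N : {pred M}) (N' : {pred M'}) t :
    (forall x, x \in N -> f x \in N') ->
  forall x, x \in iter t (@jacobson_mul R M) N ->
    f x \in iter t (@jacobson_mul R M') N'.
Proof.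
move=> fN; elim: t => [|t IH] //=; exact: linear_jacobson_mul.
Qed.

(** By induction on t, applied to the submodule of those x with J x inside N;
    this uses that J is two-sided. *)
Lemma jacobson_pow_sub (M : lmodType R) t (N : submodClosed M) :
    (forall (a : R) (x : M),
      (a : R^o) \in jacobson_pow R^o t -> a *: x \in N) ->
  {subset jacobson_pow M t <= N}.
Proof.
elim: t N => [|t IH] N JN.
  by move=> x _; rewrite -[x]scale1r JN.
have [||N' N'E] := @submod_exists R M
  (fun x => forall a : R, (a : R^o) \in jacobson R -> a *: x \in N).
- by move=> a _; rewrite scaler0 rpred0.
- move=> c x y xN yN a Ja; rewrite scalerDr scalerA rpredD ?yN // xN //.
  exact: jacobson_mulr.
apply: jacobson_mul_sub => a u Ja /IH uN'.
suff : u \in N' by rewrite N'E => /asboolP; apply.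
apply: uN' => b x Jb; rewrite N'E; apply/asboolP => j Jj; rewrite scalerA.
apply: JN; exact: (@mem_jacobson_mul R R^o).
Qed.

Lemma jacobson_pow_eq0 (M : lmodType R) t :
    (forall x : R^o, x \in jacobson_pow R^o t -> x = 0) ->
  forall x : M, x \in jacobson_pow M t -> x = 0.
Proof.
move=> Jt0; have [||Z ZE] := @submod_exists R M (fun x => x = 0) => //.
  by move=> a _ _ -> ->; rewrite scaler0 addr0.
move=> x xJ; suff : x \in Z by rewrite ZE => /asboolP.
apply: jacobson_pow_sub xJ => a y /Jt0 ->; rewrite ZE scale0r; exact/asboolP.
Qed.

(** From M = J M + N it follows that J ^ t M lies in J ^ (t + 1) M + N for all
    t, and the powers of J end at 0. *)
Lemma nakayama (M : lmodType R) (N : submodClosed M) n :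
    (forall x : R^o, x \in jacobson_pow R^o n -> x = 0) ->
    (forall x : M, exists2 k, k \in rad M & x - k \in N) ->
  forall x, x \in N.
Proof.
move=> Jn0 MN.
have step t x : x \in jacobson_pow M t ->
    exists2 k, k \in jacobson_pow M t.+1 & x - k \in N.
  elim: t x => [|t IH] x xJ; first exact: MN.
  have [||U UE] := @submod_exists R M
    (fun x => exists2 k, k \in jacobson_pow M t.+2 & x - k \in N).
  - by exists 0; rewrite ?subr0 rpred0.
  - move=> a y z [k kJ yk] [l lJ zl]; exists (a *: k + l).
      by rewrite rpredD ?rpredZ.
    by rewrite opprD addrACA -scalerBr rpredD ?rpredZ.
  suff : x \in U by rewrite UE => /asboolP.
  apply: jacobson_mul_sub xJ => a u Ja /IH[k kJ uk]; rewrite UE; apply/asboolP.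
  by exists (a *: k); [apply: mem_jacobson_mul | rewrite -scalerBr rpredZ].
have approx t x : exists2 k, k \in jacobson_pow M t & x - k \in N.
  elim: t => [|t [k /step[l lJ kl] xk]].
    by exists x; rewrite // subrr rpred0.
  by exists l => //; rewrite -(subrK k x) -addrA rpredD.
move=> x; have [k /(jacobson_pow_eq0 Jn0) ->] := approx n x.
by rewrite subr0.
Qed.

(** The map phi - 1 raises the radical filtration by one, so an element of the
    kernel of phi lies in every J ^ t M; surjectivity is Nakayama's lemma for
    the image of phi. *)
Lemma near_identity_bij (M : lmodType R) (phi : {linear M -> M}) n :
    (forall x : R^o, x \in jacobson_pow R^o n -> x = 0) ->
    (forall x, phi x - x \in rad M) ->
  injective phi /\ surjective_fun phi.
Proof.
move=> Jn0 phiJ; split.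
  have [|psi psiE] := @linear_exists R M M (fun x => phi x - x).
    by move=> a x y; rewrite linearP opprD addrACA -scalerBr.
  apply: linear_inj => x phix0; apply: (jacobson_pow_eq0 Jn0).
  elim: (n) => [|t IH] //.
  suff : psi x \in jacobson_mul (jacobson_pow M t).
    by rewrite psiE phix0 sub0r => /submodN; rewrite opprK.
  rewrite -[_ \in _]/(psi x \in jacobson_pow M t.+1) /jacobson_pow iterSr.
  by apply: (@linear_jacobson_iter _ _ psi predT) IH => y _; rewrite psiE.
have [I IE] := linear_image_submod phi.
move=> y; suff : y \in I by rewrite IE => /asboolP.
apply: (nakayama Jn0) => x; exists (x - phi x).
  by rewrite -opprB submodN.
by rewrite opprB addrC subrK IE; apply/asboolP; exists x.
Qed.

Lemma jacobson_superfluous (M : lmodType R) (K : M -> Prop) n :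
    (forall x : R^o, x \in jacobson_pow R^o n -> x = 0) ->
    (forall x, K x -> x \in rad M) -> superfluous K.
Proof.
move=> Jn0 KJ N KN; apply: (nakayama Jn0) => x.
have [k [y [/KJ kJ yN ->]]] := KN x.
by exists k => //; rewrite addrC addKr.
Qed.

End Semiprimary.

(** * Lifting idempotents *)

(** The new element is 3 e ^ 2 - 2 e ^ 3, and its defect from being idempotent
    is (3 + 4 z) z ^ 2, where z is the defect of e.  Everything takes place in
    the commutative subring generated by e. *)
Lemma idempotent_refine (R : pzRingType) (e z : R) : e * e = e - z ->
  let f := e + (e *+ 2 - 1) * z in
  exists y, f - f * f = y * (z * z).
Proof.
move=> ee.
have ez : e * z = z * e.
  by rewrite -[z in LHS](subKr e) -[z in RHS](subKr e) -ee mulrBl mulrBr mulrA.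
pose x := e *+ 2 - 1; rewrite -/x => f.
have xz : x * z = z * x.
  by rewrite /x mulrBl mulrBr mulrnAl mulrnAr ez mul1r mulr1.
have ex : e * x = x * e by rewrite /x mulrBl mulrBr mulrnAl mulrnAr mul1r mulr1.
have xx : x * x = 1 - z *+ 4.
  rewrite {2}/x mulrBr mulr1 mulrnAr {1}/x mulrBl mul1r mulrnAl ee.
  have -> : (e - z) *+ 2 - e = e - z *+ 2.
    by rewrite mulrnBl addrAC mulr2n addrK.
  rewrite mulrnBl -mulrnA /x opprB.
  by rewrite addrC addrA subrK.
have e2 : e *+ 2 = x + 1 by rewrite subrK.
clearbody x; exists (4%:R - x * x).
have ff : f * f = e * e + (e * (x * z) *+ 2) + x * x * (z * z).
  rewrite /f mulrDl !mulrDr mulr2n !addrA; congr (_ + _ + _ + _).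
    by rewrite -mulrA -ez !mulrA -ex.
  by rewrite -!mulrA; congr (_ * _); rewrite !mulrA -xz.
have exz : e * (x * z) *+ 2 = x * z + x * x * z.
  by rewrite -mulrnAl e2 mulrDl mul1r addrC mulrA.
have xxz : x * x * z = z - (z * z) *+ 4 by rewrite xx mulrBl mul1r mulrnAl.
rewrite ff exz ee /f addrACA -[_ + _ + x * x * (z * z)]addrA.
rewrite opprD addrA subrr add0r.
by rewrite xxz addKr opprD opprK mulrBl mulr_natl.
Qed.

Section Idempotents.
Variable R : pzRingType.

Lemma jacobson_powS_sub (M : lmodType R) t :
  {subset jacobson_pow M t.+1 <= jacobson_pow M t}.
Proof.
move=> x; rewrite /jacobson_pow iterSr.
by apply: (@linear_jacobson_iter R M M idfun).
Qed.

(** Each refinement raises by one the power of J that contains e - e ^ 2. *)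
Lemma idempotent_lift (c : R) n :
    (forall x : R^o, x \in jacobson_pow R^o n -> x = 0) ->
    (c - c * c : R^o) \in jacobson R ->
  exists2 e : R, e * e = e & (e - c : R^o) \in jacobson R.
Proof.
move=> Jn0 cJ.
have J1 (a : R) : (a : R^o) \in jacobson R -> (a : R^o) \in jacobson_pow R^o 1.
  move=> Ja; have := @mem_jacobson_mul R R^o predT a (1 : R) Ja isT.
  by rewrite /GRing.scale /= mulr1.
have J_of_pow t : {subset jacobson_pow R^o t.+1 <= jacobson R}.
  by apply: jacobson_mul_sub => a u Ja _; apply: jacobson_mulr.
suff approx t : exists2 e : R, (e - c : R^o) \in jacobson R
    & (e - e * e : R^o) \in jacobson_pow R^o t.+1.
  have [e ecJ eeJ] := approx n; exists e => //.
  apply/esym/eqP; rewrite -subr_eq0; apply/eqP/(Jn0 (e - e * e)).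
  exact: (jacobson_powS_sub eeJ).
elim: t => [|t [e ecJ zJ]].
  by exists c; [rewrite subrr rpred0 | exact: J1].
have zJ1 := J_of_pow _ _ zJ.
set z : R := e - e * e in zJ zJ1.
have ee : e * e = e - z by rewrite /z opprB addrC subrK.
have [y fz] := idempotent_refine ee.
exists (e + (e *+ 2 - 1) * z).
  by rewrite addrAC rpredD // mem_left_ideal_mull.
rewrite fz.
apply: (@mem_left_ideal_mull R (jacobson_mul (jacobson_pow R^o t.+1))).
exact: (@mem_jacobson_mul R R^o).
Qed.

(** The idempotent e that cuts the simple module R / m out of R: it generates
    R / m, and R e meets m only in J, so that R e is the projective cover of
    R / m. *)
Lemma idempotent_of_maximal (m : submodClosed R^o) :
    semiprimary R -> maximal_left_ideal m ->
  exists e : R, [/\ e * e = e, (1 - e : R^o) \in m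
    & forall a : R, (a * e : R^o) \in m -> (a * e : R^o) \in jacobson R].
Proof.
move=> [ssR [n Jn0]] mmax.
have Jm : {subset jacobson R <= m} by move=> a /asboolP; apply.
have [C [JC CmJ [c cC c1m]]] := left_ideal_complement m ssR.
have ccJ : (c - c * c : R^o) \in jacobson R.
  apply: CmJ; first by rewrite submodB // mem_left_ideal_mull.
  by rewrite -{1}[c]mulr1 -mulrBr mem_left_ideal_mull.
have [e ee ecJ] := idempotent_lift Jn0 ccJ.
exists e; split=> //.
  by rewrite -[1](subrK c) -addrA rpredD // -opprB submodN // Jm.
move=> a aem; apply: CmJ => //; apply: mem_left_ideal_mull.
by rewrite -[e](subrK c) rpredD // JC.
Qed.

(** * Projective modules generated by an idempotent *)

Definition Rmod_gen (e : R) : Rmod e := insubd (0 : Rmod e) (e : R^o).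

Lemma val_Rmod_gen (e : R) : val (Rmod_gen e) = e.
Proof.
by rewrite /Rmod_gen insubdK //; apply/asboolP; exists 1; rewrite mul1r.
Qed.

Lemma Rmod_valK (e : R) (y : Rmod e) : e * e = e -> (val y : R) * e = val y.
Proof. by move=> ee; case/asboolP: (valP y) => a ->; rewrite -mulrA ee. Qed.

Lemma Rmod_genE (e : R) (y : Rmod e) :
  e * e = e -> y = (val y : R) *: Rmod_gen e.
Proof.
move=> ee; apply: val_inj; rewrite [RHS]linearZ -[LHS](Rmod_valK y ee).
by congr (_ * _); apply/esym/val_Rmod_gen.
Qed.

Lemma Rmod_map (e : R) (M : lmodType R) (x : M) :
  exists f : {linear Rmod e -> M}, forall y, f y = (val y : R) *: x.
Proof.
by apply: linear_exists => a y z; rewrite linearP scalerDl scalerA.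
Qed.

Lemma Rmod_projective (e : R) : e * e = e -> projective_mod (Rmod e).
Proof.
move=> ee M N g f g_surj; have [x gx] := g_surj (f (Rmod_gen e)).
have [h hE] := Rmod_map e x.
by exists h => y; rewrite hE linearZ gx -linearZ -(Rmod_genE y ee).
Qed.

Lemma Rmod_jacobson (e : R) (y : Rmod e) :
    e * e = e -> (val y : R^o) \in jacobson R ->
  y \in rad (Rmod e).
Proof.
by move=> ee Jy; rewrite (Rmod_genE y ee) mem_jacobson_mul.
Qed.

(** * Maps of projective modules into the radical *)

Lemma scale_quot_pi1 (m : submodClosed R^o) (a : R) :
  quot_pi m a = a *: quot_pi m 1.
Proof.
transitivity (quot_pi m (a *: (1 : R^o))); last by rewrite linearZ.
by rewrite /GRing.scale /= mulr1.
Qed.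

(** The image of M lies in J Q, which is killed by J ^ (L - 1), where L is the
    Loewy length of R; so M is killed by J ^ (L - 1) as well. *)
Lemma nonmaximal_loewy (M Q : lmodType R) (f : {linear M -> Q}) n :
    (forall x : R^o, x \in jacobson_pow R^o n -> x = 0) ->
    ~ is_zero_mod M -> injective f ->
    (forall x, f x \in rad Q) ->
  ~ maximal_loewy M.
Proof.
move=> Jn0 M0 f_inj fJ; rewrite /maximal_loewy /loewy_length.
have := einfP (fun t => forall x : R^o, x \in jacobson_pow R^o t -> x = 0).
case: (einf _) => [L|/(_ n)//] [JL0 _].
(* L = 0 only for the zero ring *)
case: L JL0 => [|t] JL0.
  by case: M0 => x; rewrite -[x]scale1r (JL0 1) ?scale0r.
have : lee_nat
    (einf (fun t => forall x : M, x \in jacobson_pow M t -> x = 0)) (Some t).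
  apply: einf_le => x xJ; apply: f_inj; rewrite raddf0.
  apply: (jacobson_pow_eq0 JL0); rewrite /jacobson_pow iterSr.
  by apply: linear_jacobson_iter xJ => y _; apply: fJ.
by move=> + E; rewrite E /= ltnn.
Qed.

(** The annihilator of x modulo J P lies in a maximal left ideal m; let e be the
    idempotent attached to m and r : R e -> P the map y |-> y x.  The simple
    module is R / m, covered by f0 : R e -> R / m.  Since the kernel of r
    modulo J P lies in the kernel of f0, semisimplicity of P / J P gives a map
    f : P -> R / m that restricts to f0 along r.  Lifting f through f0 gives
    s : P -> R e with s r congruent to the identity modulo J, so that r is
    injective, and i r embeds R e in J Q.  A factorisation of f through i would
    send x, and hence e x, into J (R / m) = 0, although f (e x) = f0 e is not
    zero. *)
Lemma simple_top_of_radical_map (P Q : lmodType R) (i : {linear P -> Q})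
    (x : P) :
    semiprimary R -> projective_mod P -> injective i ->
    i x \in rad Q ->
    x \notin rad P ->
  exists S : lmodType R,
    [/\ simple_mod S,
        exists (C : lmodType R) (p : {linear C -> S}),
          projective_cover p /\ ~ maximal_loewy C
      & exists f : {linear P -> S},
          ~ exists g : {linear Q -> S}, forall y, g (i y) = f y].
Proof.
move=> spR projP i_inj ixJ xJ; have [ssR [n Jn0]] := spR.
have [rx rxE] := scaler_linear x.
have [I IE] := linear_preimage_submod rx (jacobson_mul predT).
have [|m [Im m1 mmax]] := @maximal_avoiding R R^o I (fun a => a = 1).
  by move=> a + a1; rewrite IE rxE a1 scale1r (negbTE xJ).
have {}mmax : maximal_left_ideal m.
  split; first by exists 1; apply/negP => /m1.
  move=> N mN; have [N1|N1] := pselect ((1 : R^o) \in N).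
    by right=> a; have := mem_left_ideal_mull a N1; rewrite mulr1.
  by left; apply: mmax => // a aN a1; apply: N1; rewrite -a1.
have [e [ee e1m emJ]] := idempotent_of_maximal spR mmax.
have [r rE] := Rmod_map e x.
have [f0 f0E] := Rmod_map e (quot_pi m 1).
have f0_pi y : f0 y = quot_pi m (val y).
  by rewrite f0E; apply/esym/scale_quot_pi1.
have kerf0 y : f0 y = 0 -> y \in rad (Rmod e).
  rewrite f0_pi => /quot_pi_eq0; rewrite -(Rmod_valK y ee) => /emJ yJ.
  by apply: Rmod_jacobson => //; rewrite -(Rmod_valK y ee).
have gen1 : f0 (Rmod_gen e) = quot_pi m 1.
  rewrite f0_pi val_Rmod_gen; apply/quot_pi_eq; rewrite -opprB; exact: submodN.
have f0_surj : surjective_fun f0.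
  move=> q; have [a <-] := quot_pi_surj q.
  exists ((a : R) *: Rmod_gen e); rewrite linearZ gen1.
  exact/esym/scale_quot_pi1.
have Ssimple := maximal_quot_simple mmax.
have gen0 : f0 (Rmod_gen e) <> 0.
  by rewrite gen1 => /quot_pi_eq0 /m1.
(* h is defined on all of P / J P because that module is semisimple *)
have [||h hE] :=
    @semisimple_extend R (Rmod e) (top_mod P) _ (top_pi P \o r) f0.
- by apply: killed_semisimple => // a v; apply: jacobson_top.
- move=> y /quot_pi_eq0; rewrite rE -rxE -IE => /Im ym.
  by rewrite f0_pi; apply/quot_pi_eq0.
pose f : {linear P -> quot_mod m} := h \o top_pi P.
have [s sE] := projective_lift projP (fun y => f0_surj (f y)).
have [|sr_inj _] := @near_identity_bij R (Rmod e) (s \o r) n Jn0.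
  move=> y; apply: kerf0; rewrite linearB; apply/eqP; rewrite subr_eq0.
  exact/eqP/(etrans (sE _) (hE _)).
have r_inj : injective r.
  by move=> y z yz; apply: sr_inj; rewrite /= yz.
exists (quot_mod m); split=> //.
  exists (Rmod e), f0; split.
    split=> //; first exact: Rmod_projective.
    exact: (jacobson_superfluous Jn0).
  apply: (@nonmaximal_loewy _ _ (i \o r) n) => //.
  - by move=> /(_ (Rmod_gen e)) g0; apply: gen0; rewrite g0 raddf0.
  - exact: inj_comp.
  - by move=> y; rewrite /= rE linearZ rpredZ.
exists f => -[g gE]; apply: gen0.
have <- := etrans (gE _) (hE (Rmod_gen e)); rewrite rE linearZ.
by apply: (jacobson_mul_simple g Ssimple); rewrite rpredZ.
Qed.
End Idempotents.

(** * Projective resolutions and Ext *)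

Section Resolutions.
Variable R : pzRingType.

(** This is Ext ^ (k + 1) (_, S) = 0 for k >= n, with cocycles in place of
    homology classes.  By dimension shifting: extend eta f to g : P k -> I 0;
    modulo S, the map g is a cocycle with values in the cosyzygy C, hence a
    coboundary by induction, and correcting g by a lift of it to I 0 brings g
    back into S. *)
Lemma ext_vanishing (P : nat -> lmodType R)
    (d : forall i, {linear P i.+1 -> P i}) n (S : lmodType R) :
    (forall i, projective_mod (P i)) ->
    (forall i, exact_at (d i.+1) (d i)) -> inj_resolution_le S n ->
  forall k (f : {linear P k.+1 -> S}), (n <= k)%N ->
    (forall y, f (d k.+1 y) = 0) ->
  exists g : {linear P k -> S}, forall y, g (d k y) = f y.
Proof.
move=> projP exP; elim: n S => [|n IH] S;
  move=> [I [dI [eta [injI eta_inj ex_eta exI I0]]]] k f nk fd0.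
all: have [|g /= gE] := @injective_extend R _ _ _ (d k) (eta \o f) (injI 0%N);
  first by move=> y /exP[z <-]; rewrite /= fd0 raddf0.
  have [|h hE] := @projective_lift R _ _ _ eta g (projP k).
    by move=> x; apply/ex_eta; apply: I0.
  by exists h => y; apply: eta_inj; rewrite hE gE.
case: k f nk fd0 g gE => // k f nk fd0 g gE.
have [C CE] := linear_kernel_submod (dI 1%N).
have dIC x : dI 0%N x \in C.
  by rewrite CE; apply/asboolP/exI; exists x.
have [q qE] := corestrict dIC.
have q_surj : surjective_fun q.
  move=> c; have := valP c; rewrite CE => /asboolP/exI[x xc].
  by exists x; apply: val_inj; rewrite qE.
have resC : inj_resolution_le (submod_of C) n.
  exists (fun i => I i.+1), (fun i => dI i.+1), (submod_incl C).
  split=> //.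
  - exact: val_inj.
  - move=> y; split=> [y0|[x <-]].
      have yC : y \in C by rewrite CE; apply/asboolP.
      by exists (Sub y yC).
    by have := valP x; rewrite CE => /asboolP.
  - by move=> i ni; apply: I0.
have [//||g1 /= g1E] := IH _ resC k (q \o g).
  move=> y; rewrite /= gE; apply: val_inj; rewrite qE raddf0.
  by apply/ex_eta; exists (f y).
have [|g2 g2E] := @projective_lift R _ _ _ q g1 (projP k).
  by move=> x; apply: q_surj.
(* the corrected cocycle dies in C, so it lifts through eta *)
have [|h /= hE] := @projective_lift R _ _ _ eta (g \- (g2 \o d k)) (projP k.+1).
  move=> x; apply/ex_eta; rewrite -qE /= linearB g2E g1E subrr.
  exact: (raddf0 (submod_incl C)).
exists h => y; apply: eta_inj; rewrite hE gE.
have -> : d k (d k.+1 y) = 0 by apply/exP; exists y.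
by rewrite raddf0 subr0.
Qed.

Lemma resolution_cons (P M : lmodType R) (K : submodClosed P)
    (p : {linear P -> M}) n :
    projective_mod P -> surjective_fun p ->
    (forall x, p x = 0 <-> x \in K) -> proj_resolution_le (submod_of K) n ->
  proj_resolution_le M n.+1.
Proof.
move=> projP p_surj kerp [Q [d [eps [projQ eps_surj ex_eps exQ Q0]]]].
pose P' i := if i is j.+1 then Q j else P.
pose d' i : {linear P' i.+1 -> P' i} :=
  match i return {linear P' i.+1 -> P' i} with
  | 0%N => submod_incl K \o eps
  | j.+1 => d j
  end.
exists P', d', p; split=> //.
- by case.
- move=> x; split=> [/kerp xK|[y <-]].
    have [y yx] := eps_surj (Sub x xK); exists y.
    exact: (congr1 val yx).
  by apply/kerp; apply: valP.
- case=> [|i] //= y; split=> [y0|/ex_eps y0]; last first.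
    exact: etrans (congr1 val y0) (raddf0 (submod_incl K)).
  apply/ex_eps/val_inj; apply: etrans y0 _.
  exact/esym/(raddf0 (submod_incl K)).
- by case=> [|i] // ni; apply: Q0.
Qed.

Lemma zero_mod_exists : exists Z : lmodType R, is_zero_mod Z.
Proof.
have [Z ZE] := linear_kernel_submod (idfun : {linear R^o -> R^o}).
exists (submod_of Z) => x; apply: val_inj.
have := valP x; rewrite ZE => /asboolP x0; apply: etrans x0 _.
exact/esym/(raddf0 (submod_incl Z)).
Qed.

Lemma projective_retract (P M : lmodType R) (s : {linear M -> P})
    (p : {linear P -> M}) :
  cancel s p -> projective_mod P -> projective_mod M.
Proof.
move=> sK projP A B g f g_surj.
have [h hE] := projP A B g (f \o p) g_surj.
by exists (h \o s) => x; rewrite /= hE /= sK.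
Qed.

Lemma resolution_projective (M : lmodType R) :
  projective_mod M -> proj_resolution_le M 0.
Proof.
move=> projM; have [Z Z0] := zero_mod_exists.
pose P i := if i is 0%N then M else Z.
exists P, (fun i => \0 : {linear P i.+1 -> P i}), idfun; split=> //.
- case=> [|i] //= A B g f g_surj; exists \0 => x.
  by rewrite [x]Z0 !raddf0.
- by move=> x; exists x.
- by move=> x; split=> [x0|[y <-] //]; exists 0; apply: esym.
- by move=> i x; split=> // _; exists 0; rewrite [x]Z0.
- by case.
Qed.

(** Pass from M to its first syzygy until only P 1 -> P 0 -> M is left, where
    the splitting makes M a direct summand of P 0. *)
Lemma split_truncation n (M : lmodType R) (P : nat -> lmodType R)
    (d : forall i, {linear P i.+1 -> P i}) (eps : {linear P 0%N -> M})
    (r : {linear P n -> P n.+1}) :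
    (forall i, projective_mod (P i)) -> surjective_fun eps ->
    exact_at (d 0%N) eps -> (forall i, exact_at (d i.+1) (d i)) ->
    cancel (d n) r ->
  proj_resolution_le M n.
Proof.
elim: n M P d eps r => [|n IH] M P d eps r projP eps_surj ex_eps exP dK.
  apply: resolution_projective.
  (* the projection of P 0 along the image of d 0, seen as a section of eps *)
  have [|s /= sE] :=
      @linear_factor R _ _ _ eps (idfun \- (d 0%N \o r)) eps_surj.
    by move=> x /ex_eps[y <-]; rewrite /= dK subrr.
  apply: (@projective_retract _ _ s eps) => // m.
  have [x <-] := eps_surj m; rewrite sE linearB.
  suff -> : eps (d 0%N (r x)) = 0 by rewrite subr0.
  by apply/ex_eps; exists (r x).
have [K KE] := linear_kernel_submod eps.
have kerK x : eps x = 0 <-> x \in K by rewrite KE; split=> /asboolP.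
have [|e eE] := @corestrict R _ _ K (d 0%N).
  by move=> x; apply/kerK/ex_eps; exists x.
apply: (@resolution_cons _ _ K eps) => //.
apply: (IH _ (fun i => P i.+1) (fun i => d i.+1) e r) => //.
- move=> y; have /kerK/ex_eps[x xy] := valP y.
  by exists x; apply: val_inj; rewrite eE.
- move=> x; split=> [ex0|/exP x0]; last by apply: val_inj; rewrite eE x0 raddf0.
  by apply/exP; rewrite -eE ex0 raddf0.
Qed.

(** The map induced by i on tops is injective, hence has a retraction as the
    top of Q is semisimple.  Lift the retraction to s : Q -> P; then s i is
    congruent to the identity modulo J, hence bijective. *)
Lemma radical_injection_split (P Q : lmodType R) (i : {linear P -> Q}) :
    semiprimary R -> projective_mod Q ->
    (forall x, i x \in rad Q -> x \in rad P) ->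
  exists r : {linear Q -> P}, cancel i r.
Proof.
move=> [ssR [n Jn0]] projQ iJ.
have [||h hE] := @semisimple_extend R P (top_mod Q) (top_mod P)
  (top_pi Q \o i) (top_pi P).
- by apply: killed_semisimple => // a v; apply: jacobson_top.
- by move=> y /quot_pi_eq0/iJ ?; apply/quot_pi_eq0.
have [s sE] :=
  projective_lift projQ (fun q => quot_pi_surj ((h \o top_pi Q) q)).
have [|phi_inj phi_surj] := @near_identity_bij R _ (s \o i) n Jn0.
  move=> x; apply/quot_pi_eq.
  exact: etrans (sE _) (hE x).
have [psi [psiK _]] := linear_inverse phi_inj phi_surj.
by exists (psi \o s) => x; exact: psiK.
Qed.

(** Minimality of the projective dimension says that the last map of a shortest
    resolution does not split, so that it sends some element outside the
    radical into the radical. *)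
Lemma projdim_le_injdim_simple (M : lmodType R) n :
    semiprimary R -> projdim M = Some n.+1 ->
  exists S : lmodType R,
    [/\ simple_mod S,
        exists (C : lmodType R) (p : {linear C -> S}),
          projective_cover p /\ ~ maximal_loewy C
      & lee_nat (Some n.+1) (injdim S)].
Proof.
move=> spR pdM; have := einfP (proj_resolution_le M).
rewrite [einf _]pdM => -[[P [d [eps [projP eps_surj ex_eps exP P0]]]] minM].
have zeroP (y : P n.+2) : y = 0 by apply: P0.
have d_inj : injective (d n).
  by apply: linear_inj => x /exP[y <-]; rewrite [y]zeroP raddf0.
have [x [dxJ xJ]] : exists x, d n x \in rad (P n)
    /\ x \notin rad (P n.+1).
  apply: contrapT => noX.
  have [|r rK] := @radical_injection_split _ _ (d n) spR (projP n).
    by move=> x dxJ; apply: contrapT => /negP xJ; apply: noX; exists x.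
  by have /minM := split_truncation projP eps_surj ex_eps exP rK; rewrite ltnn.
have [S [Ssimple coverS [f no_ext]]] :=
  simple_top_of_radical_map spR (projP n.+1) d_inj dxJ xJ.
exists S; split=> //.
rewrite /injdim.
case: (einf _) (einfP (inj_resolution_le S)) => // k [resS _] /=.
rewrite ltnNge; apply/negP => kn; apply: no_ext.
apply: (ext_vanishing projP exP resS kn) => y.
by rewrite [y]zeroP !raddf0.
Qed.
End Resolutions.

(** * Simple modules and primitive idempotents *)

Section PrimitiveIdempotents.
Variable R : pzRingType.

Lemma inj_resolution_iso (S T : lmodType R) (u : {linear S -> T}) n :
    injective u -> surjective_fun u -> inj_resolution_le T n ->
  inj_resolution_le S n.
Proof.
move=> u_inj u_surj [I [d [eta [injI eta_inj ex_eta exI I0]]]].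
exists I, d, (eta \o u); split=> //; first exact: inj_comp.
move=> y; split=> [/ex_eta[t <-]|[x <-]].
  by have [x <-] := u_surj t; exists x.
by apply/ex_eta; exists (u x).
Qed.

Lemma loewy_length_iso (M N : lmodType R) (f : {linear M -> N}) :
  injective f -> surjective_fun f -> loewy_length M = loewy_length N.
Proof.
move=> f_inj f_surj; have [g [fK gK]] := linear_inverse f_inj f_surj.
have pow0 (A B : lmodType R) (u : {linear A -> B}) t : injective u ->
    (forall x : B, x \in jacobson_pow B t -> x = 0) ->
    (forall x : A, x \in jacobson_pow A t -> x = 0).
  move=> u_inj B0 x xJ; apply: u_inj; rewrite raddf0; apply: B0.
  exact: linear_jacobson_iter xJ.
congr einf; apply/funext => t; apply/propext; split; apply: pow0.
  exact: can_inj gK.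
exact: f_inj.
Qed.

(** The components a and b of e along a decomposition of R e are orthogonal
    idempotents with sum e. *)
Lemma Rmod_indecomposable (e : R) :
  primitive_idempotent e -> indecomposable_mod (Rmod e).
Proof.
move=> [ee e0 e_prim]; split.
  by move=> /(_ (Rmod_gen e)) /(congr1 val); rewrite val_Rmod_gen.
move=> A B [AB0 AB1]; have [a [b [aA bB ab]]] := AB1 (Rmod_gen e).
have eab : e = (val a : R) + val b by rewrite -[LHS]val_Rmod_gen ab.
have sum0 (x y : Rmod e) : x \in A -> y \in B -> x + y = 0 -> x = 0 /\ y = 0.
  move=> xA yB xy; have x0 : x = 0.
    apply: AB0 => //; have -> : x = - y by apply/eqP; rewrite -addr_eq0 xy.
    exact: submodN.
  by move: xy; rewrite x0 add0r.
have ida : a = (val a : R) *: a /\ (val a : R) *: b = 0.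
  have [|||x y] := sum0 ((val a : R) *: a - a) ((val a : R) *: b).
  - by rewrite submodB // rpredZ.
  - by rewrite rpredZ.
  - apply: val_inj; rewrite addrAC -scalerDr -ab.
    by rewrite -(Rmod_genE a ee) subrr.
  by split=> //; apply/eqP; rewrite eq_sym -subr_eq0 x.
have idb : b = (val b : R) *: b /\ (val b : R) *: a = 0.
  have [|||x y] := sum0 ((val b : R) *: a) ((val b : R) *: b - b).
  - by rewrite rpredZ.
  - by rewrite submodB // rpredZ.
  - by rewrite addrA -scalerDr -ab -(Rmod_genE b ee) subrr.
  by split=> //; apply/eqP; rewrite eq_sym -subr_eq0 y.
have gen_in (N : submodClosed (Rmod e)) y : Rmod_gen e \in N -> y \in N.
  by move=> gN; rewrite (Rmod_genE y ee) rpredZ.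
have [||||a0|b0] := e_prim (val a) (val b) _ _ _ _ eab.
- exact/esym/(congr1 val (proj1 ida)).
- exact/esym/(congr1 val (proj1 idb)).
- exact: (congr1 val (proj2 ida)).
- exact: (congr1 val (proj2 idb)).
- left=> x xA; apply: AB0 => //; apply: gen_in.
  by rewrite ab (_ : a = 0) ?add0r //; apply: val_inj; rewrite a0.
- right=> x xB; apply: AB0 => //; apply: gen_in.
  by rewrite ab (_ : b = 0) ?addr0 //; apply: val_inj; rewrite b0.
Qed.

Lemma Rmod_direct_summand (e f : R) :
    e * e = e -> f * f = f -> e * f = e -> f * e = e ->
  is_direct_summand (Rmod e) (Rmod f).
Proof.
move=> ee ff ef fe; pose g := f - e.
have gf : g * f = g by rewrite mulrBl ff ef.
have ge : g * e = 0 by rewrite mulrBl fe ee subrr.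
have gg : g * g = g by rewrite {2}/g mulrBr gf ge subr0.
exists (Rmod g).
pose s : {linear (Rmod e * Rmod g)%type -> R^o} :=
  (submod_incl (principal_left e) \o fst) \+
  (submod_incl (principal_left g) \o snd).
have sE x : s x = (val x.1 : R) + val x.2 by [].
have [|h hE] := @corestrict R _ _ (principal_left f) s.
  move=> x; rewrite sE; apply/asboolP; exists ((val x.1 : R) + val x.2).
  rewrite mulrDl -(Rmod_valK x.1 ee) -(Rmod_valK x.2 gg).
  by rewrite -!mulrA ef gf.
have valh x : (val (h x) : R) = (val x.1 : R) + val x.2 by rewrite hE sE.
have h_inj : injective h.
  apply: linear_inj => -[x y] hxy0.
  have xy0 : (val x : R) + val y = 0 by rewrite -(valh (x, y)) hxy0.
  have x0 : (val x : R) = 0.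
    have := congr1 (fun c : R => c * e) xy0.
    by rewrite mul0r mulrDl -(Rmod_valK y gg) -mulrA ge mulr0 addr0 Rmod_valK.
  have y0 : (val y : R) = 0 by move: xy0; rewrite x0 add0r.
  by congr (_, _); apply: val_inj.
have h_surj : surjective_fun h.
  move=> y; exists ((val y : R) *: Rmod_gen e, (val y : R) *: Rmod_gen g).
  apply: val_inj; apply: etrans (valh _) _.
  transitivity ((val y : R) * e + (val y : R) * g); last first.
    by rewrite -mulrDr addrC subrK Rmod_valK.
  congr (_ + _); apply: (congr1 (fun c : R => val y * c));
    exact: val_Rmod_gen.
by exists h; have [v [hK vK]] := linear_inverse h_inj h_surj; exists v.
Qed.

(** Let N be the preimage in P of a complement, in the top of P, of the image of
    the kernel.  The kernel and N span P, so N = P and that image is 0. *)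
Lemma superfluous_kernel_jacobson (P S : lmodType R) (p : {linear P -> S}) :
    semiprimary R -> superfluous (fun x => p x = 0) ->
  forall x, p x = 0 -> x \in rad P.
Proof.
move=> [ssR _] sup; have [K KE] := linear_kernel_submod p.
have [A AE] := linear_image_submod (top_pi P \o submod_incl K).
have [|B [AB0 AB1]] := @killed_semisimple R (top_mod P) ssR _ A.
  by move=> a v; apply: jacobson_top.
have [N NE] := linear_preimage_submod (top_pi P) B.
have piA x : p x = 0 -> top_pi P x \in A.
  move=> px; have xK : x \in K by rewrite KE; apply/asboolP.
  by rewrite AE; apply/asboolP; exists (Sub x xK).
have N1 : forall x, x \in N.
  apply: sup => x; have [c [b [aA bB xab]]] := AB1 (top_pi P x).
  move: aA xab; rewrite AE => /asboolP[k <-] xab; exists (val k), (x - val k).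
  split; last by rewrite addrC subrK.
    by have := valP k; rewrite KE => /asboolP.
  by rewrite NE linearB xab addrC addKr.
move=> x px; apply/quot_pi_eq0/(AB0 (top_pi P x)); first exact: piA.
by rewrite -NE.
Qed.

(** Since 1 is the sum of the e i, some e i does not kill S, and y |-> y s maps
    R (e i) onto S.  This map lifts to phi : R (e i) -> P, which is onto because
    the kernel of p is superfluous, splits because P is projective, and is
    therefore bijective because R (e i) is indecomposable. *)
Lemma simple_iso_top (n : nat) (e : 'I_n -> R) (S P : lmodType R)
    (p : {linear P -> S}) :
    semiprimary R -> complete_primitive_orthogonal e -> simple_mod S ->
    projective_cover p ->
  exists i : 'I_n,
    loewy_length (Rmod (e i)) = loewy_length P /\
    exists u : {linear S -> top_mod (Rmod (e i))},
      injective u /\ surjective_fun u.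
Proof.
move=> spR [e_prim e_orth e1] Ssimple [projP p_surj p_sup].
have [S0 S_sub] := Ssimple.
have [s s0] : exists s : S, s <> 0.
  apply: contrapT => no; apply: S0 => s.
  by apply: contrapT => s0; apply: no; exists s.
have [i es0] : exists i, e i *: s <> 0.
  apply: contrapT => no; apply: s0.
  rewrite -[s]scale1r -e1 scaler_suml big1 // => i _.
  by apply: contrapT => es0; apply: no; exists i.
exists i; have [ee _ _] := e_prim i.
have [q qE] := Rmod_map (e i) s.
have q_surj : surjective_fun q.
  have [I IE] := linear_image_submod q.
  have [I0|I1] := S_sub I; last first.
    by move=> x; have := I1 x; rewrite IE => /asboolP.
  case: es0; apply: I0; rewrite IE; apply/asboolP.
  by exists (Rmod_gen (e i)); rewrite qE val_Rmod_gen.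
have [phi phiE] := projective_lift (Rmod_projective ee) (fun y => p_surj (q y)).
have phi_surj : surjective_fun phi.
  have [I IE] := linear_image_submod phi.
  suff I1 x : x \in I by move=> x; have := I1 x; rewrite IE => /asboolP.
  apply: p_sup x => x; have [y yx] := q_surj (p x).
  exists (x - phi y), (phi y); rewrite linearB phiE yx subrr subrK; split=> //.
  by rewrite IE; apply/asboolP; exists y.
have [psi psiK] := projective_lift projP (fun x => phi_surj (idfun x)).
have phi_inj : injective phi.
  have [A AE] := linear_image_submod psi.
  have [B BE] := linear_kernel_submod phi.
  have [_ indec] := Rmod_indecomposable (e_prim i).
  apply: linear_inj; case: (indec A B).
  - split=> [x|x].
      rewrite AE BE => /asboolP[y <-] /asboolP; rewrite psiK /= => ->.
      by rewrite raddf0.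
    exists (psi (phi x)), (x - psi (phi x)); split; last by rewrite addrC subrK.
      by rewrite AE; apply/asboolP; exists (phi x).
    by rewrite BE; apply/asboolP; rewrite linearB psiK subrr.
  - move=> A0; case: s0; have [x <-] := p_surj s.
    rewrite -[x](psiK x) (A0 (psi x)) ?raddf0 //.
    by rewrite AE; apply/asboolP; exists x.
  - by move=> B0 x phix0; apply: B0; rewrite BE; apply/asboolP.
split; first exact: (loewy_length_iso phi_inj phi_surj).
have [phiV [phiK _]] := linear_inverse phi_inj phi_surj.
have kerq y : q y = 0 <-> top_pi _ y = 0.
  split=> [qy0|/quot_pi_eq0 yJ].
    apply/quot_pi_eq0; rewrite -[y]phiK.
    apply: (@linear_jacobson_mul _ _ _ phiV predT) => //.
    by apply: (superfluous_kernel_jacobson spR p_sup); rewrite phiE.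
  exact: jacobson_mul_simple.
have [|u uE] := linear_factor q_surj (f := top_pi (Rmod (e i))).
  by move=> y /kerq.
exists u; split.
  apply: linear_inj => x; have [y <-] := q_surj x.
  by rewrite uE => /kerq.
by move=> t; have [y <-] := quot_pi_surj t; exists (q y); rewrite uE.
Qed.
End PrimitiveIdempotents.

(** * The finitistic dimension *)

Section FinitisticDimension.
Variable R : pzRingType.

Lemma Findim_le_esup (B : enat -> Prop) :
    (forall (M : lmodType R) n, projdim M = Some n.+1 ->
      exists2 d, B d & lee_nat (Some n.+1) d) ->
  lee_nat (Findim R) (esup B).
Proof.
move=> boundB; rewrite /esup.
have := einfP (fun N => forall d, B d -> lee_nat d (Some N)).
case: (einf _) => [N [NB _]|_]; last by case: (Findim R).
apply: einf_le => _ [M [Mfin ->]]; case E: (projdim M) Mfin => [[|n]|] // _.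
have [d /NB] := boundB M n E; case: d => // k kN nk; exact: leq_trans nk kN.
Qed.

(** Multiplying e i by a subsum of the orthogonal family that contains e i
    leaves e i. *)
Lemma e_infty_absorbs (n : nat) (e : 'I_n -> R) :
    complete_primitive_orthogonal e ->
  e_infty e * e_infty e = e_infty e /\
  forall i, injdim (top_mod (Rmod (e i))) = None ->
    e i * e_infty e = e i /\ e_infty e * e i = e i.
Proof.
move=> [e_prim e_orth _].
have ei i : injdim (top_mod (Rmod (e i))) = None ->
    e i * e_infty e = e i /\ e_infty e * e i = e i.
  move=> /asboolP einf; have [ee _ _] := e_prim i.
  rewrite mulr_sumr mulr_suml.
  rewrite (bigD1 i) //= ee big1 => [|j /andP[_ ji]]; last first.
    by rewrite e_orth // eq_sym.
  rewrite (bigD1 i) //= ee big1 ?addr0 // => j /andP[_ ji].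
  exact: e_orth.
split=> //; rewrite {1}/e_infty mulr_suml.
by apply: eq_bigr => i /asboolP /ei[].
Qed.

End FinitisticDimension.

Theorem theorem4p4 (R : pzRingType) (semiprimaryR : semiprimary R) :
  lee_nat (Findim R)
    (esup (fun d : enat =>
       exists S : lmodType R,
         [/\ simple_mod S,
             exists (P : lmodType R) (p : {linear P -> S}),
               projective_cover p /\ ~ maximal_loewy P
           & d = injdim S]))
  /\ (forall (n : nat) (e : 'I_n -> R),
        complete_primitive_orthogonal e -> quasi_uniform_loewy e ->
        Findim R <> None).
Proof.
set B := fun d : enat => _.
have Findim_le : lee_nat (Findim R) (esup B).
  apply: Findim_le_esup => M n.
  move/(projdim_le_injdim_simple semiprimaryR) => [S [Ssimple coverS nS]].
  by exists (injdim S) => //; exists S.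
split=> // n e e_complete e_unif Findim_inf.
(* a bound for the finite values; the default 0 stands for the infinite ones,
   which belong to covers of maximal Loewy length *)
pose k i := odflt 0%N (injdim (top_mod (Rmod (e i)))).
have := einfP (fun N => forall d, B d -> lee_nat d (Some N)).
move: Findim_le; rewrite Findim_inf /esup; case: (einf _) => // _.
move/(_ (\max_i k i)%N); apply => _ [S [Ssimple [P [p [p_cover Pnonmax]]] ->]].
have [i [loewyP [u [u_inj u_surj]]]] :=
  simple_iso_top semiprimaryR e_complete Ssimple p_cover.
have [e_prim _ _] := e_complete; have [ee _ _] := e_prim i.
have [EE eE] := e_infty_absorbs e_complete.
case E: (injdim (top_mod (Rmod (e i)))) => [l|].
  have := einfP (inj_resolution_le (top_mod (Rmod (e i)))).
  rewrite [einf _]E => -[/(inj_resolution_iso u_inj u_surj)/einf_le le_l _].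
  have lk : (l <= \max_i k i)%N by rewrite (leq_trans _ (leq_bigmax i)) // /k E.
  move: le_l; rewrite -/(injdim S); case: (injdim S) => //= m ml.
  exact: leq_trans ml lk.
have [eiE Eei] := eE i E; case: Pnonmax; rewrite /maximal_loewy -loewyP.
apply: e_unif; first exact: Rmod_indecomposable.
  exact: Rmod_projective.
exact: Rmod_direct_summand.
Qed.
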